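(* Let $(A,+_A,\cdot_A,\alpha)$ be a unitary regular Hom-ring with compatible ring $(A,+_A',\cdot_A')$. Suppose that $(M,+_M')$ is a simple left module over the ring $(A,+_A',\cdot_A')$ for the action $a\rhd m$. If there exists an automorphism $\beta$ of the group $(M,+_M')$ such that $\beta(a\rhd m)=\alpha(a)\rhd\beta(m)$ for all $a\in A$, $m\in M$, then $(M,+_M=\beta\circ +_M',\beta)$ is a simple left module over $(A,+_A,\cdot_A,\alpha)$ with respect to the action $am=\beta(a\rhd m)$, for all $a\in A$ and $m\in M$.
   Context: An abelian Hom-group $(M,+,0,\beta)$ is a set $M$ with an element $0$, a commutative operation $+$ and a map $\beta:M\to M$ such that for all $x,y,z$: $\beta(x)+(y+z)=(x+y)+\beta(z)$; $\beta(x+y)=\beta(x)+\beta(y)$; $x+0=0+x=\beta(x)$, $\beta(0)=0$; there is a map $x\mapsto-x$ with $-(x+y)=(-y)+(-x)$; for each $x$ there is a natural number $k$ with $\beta^k(x+(-x))=0$. Here ''Hom-ring'' means $\alpha$-Hom-ring of type $(1)$: $(A,+,\cdot,0,\alpha)$ such that $(A,+,0,\alpha)$ is an abelian Hom-group, $\alpha(xy)=\alpha(x)\alpha(y)$, $\alpha(x)(yz)=(xy)\alpha(z)$, $\alpha(x)(y+z)=xy+xz$ and $(y+z)\alpha(x)=yx+zx$ for all $x,y,z\in A$. It is unitary if there is $1_A\in A$ with $x1_A=1_Ax=\alpha(x)$ for all $x$ and $\alpha(1_A)=1_A$; regular if $\alpha$ is bijective. The compatible ring of a regular Hom-ring is the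 ring $(A,+',\cdot',0)$ with $x+'y=\alpha^{-1}(x+y)$, $x\cdot'y=\alpha^{-1}(x\cdot y)$. A left $A$-module over a unitary Hom-ring $A$ is an abelian Hom-group $(M,+_M,\beta)$ with an action $A\times M\to M$, $(a,m)\mapsto am$, such that $\alpha(a)(m_1+_Mm_2)=am_1+_Mam_2$, $(a+b)\beta(m)=am+_Mbm$, $(a\cdot b)\beta(m)=\alpha(a)(bm)$, $1_Am=\beta(m)$ for all $a,b\in A$, $m,m_1,m_2\in M$. An $A$-submodule is a Hom-subgroup $N$ of $M$ (a subset which is a Hom-group under the restricted structure with the same zero) which is itself a module under the action of $A$. $M$ is simple if it is non-zero and has no submodules except $\{0\}$ and itself. $\beta\circ+_M'$ denotes $(x,y)\mapsto\beta(x+_M'y)$. *)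

(* Defs.v *)
From HB Require Import structures.
From mathcomp Require Import all_boot all_order all_algebra.
From mathcomp Require Import boolp classical_sets.

Set Implicit Arguments.
Unset Strict Implicit.
Unset Printing Implicit Defensive.

Import GRing.Theory.
Local Open Scope classical_set_scope.
Local Open Scope ring_scope.

(* [abelian_hom_group_on N add zero beta]: the subset [N], with the operations
   restricted to it, is an abelian Hom-group with zero [zero].  A Hom-group
   structure on the whole carrier is the case [N = setT]; a Hom-subgroup is a
   general [N].  The map x |-> -x is not part of the structure; only its
   existence on [N] is required. *)
Record abelian_hom_group_on (M : Type) (N : set M)
    (add : M -> M -> M) (zero : M) (beta : M -> M) : Prop :=
  AbelianHomGroupOn {
  hg_zero_in : N zero;
  hg_add_in : forall x y, N x -> N y -> N (add x y);
  hg_beta_in : forall x, N x -> N (beta x);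
  hg_addC : forall x y, N x -> N y -> add x y = add y x;
  hg_addA : forall x y z, N x -> N y -> N z ->
    add (beta x) (add y z) = add (add x y) (beta z);
  hg_betaD : forall x y, N x -> N y -> beta (add x y) = add (beta x) (beta y);
  hg_addr0 : forall x, N x -> add x zero = beta x;
  hg_add0r : forall x, N x -> add zero x = beta x;
  hg_beta0 : beta zero = zero;
  hg_opp : exists opp : M -> M,
    [/\ forall x, N x -> N (opp x),
        forall x y, N x -> N y -> opp (add x y) = add (opp y) (opp x) &
        forall x, N x -> exists k : nat, iter k beta (add x (opp x)) = zero] }.

Definition abelian_hom_group (M : Type) (add : M -> M -> M) (zero : M)
    (beta : M -> M) : Prop :=
  abelian_hom_group_on setT add zero beta.

(* Unitary alpha-Hom-rings of type (1).  The unit is unique, hence it can be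
   recorded as data. *)
Record unitaryHomRing := UnitaryHomRing {
  hr_sort :> choiceType;
  hr_add : hr_sort -> hr_sort -> hr_sort;
  hr_mul : hr_sort -> hr_sort -> hr_sort;
  hr_zero : hr_sort;
  hr_one : hr_sort;
  hr_alpha : hr_sort -> hr_sort;
  hr_group : abelian_hom_group hr_add hr_zero hr_alpha;
  hr_alphaM : forall x y,
    hr_alpha (hr_mul x y) = hr_mul (hr_alpha x) (hr_alpha y);
  hr_mulA : forall x y z,
    hr_mul (hr_alpha x) (hr_mul y z) = hr_mul (hr_mul x y) (hr_alpha z);
  hr_mulDr : forall x y z,
    hr_mul (hr_alpha x) (hr_add y z) = hr_add (hr_mul x y) (hr_mul x z);
  hr_mulDl : forall x y z,
    hr_mul (hr_add y z) (hr_alpha x) = hr_add (hr_mul y x) (hr_mul z x);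
  hr_mulr1 : forall x, hr_mul x hr_one = hr_alpha x;
  hr_mul1r : forall x, hr_mul hr_one x = hr_alpha x;
  hr_alpha1 : hr_alpha hr_one = hr_one }.

Arguments hr_add {_} _ _.
Arguments hr_mul {_} _ _.
Arguments hr_zero {_}.
Arguments hr_one {_}.
Arguments hr_alpha {_} _.

Definition regular (A : unitaryHomRing) : Prop := bijective (@hr_alpha A).

(* An alias of the carrier of [A], so that x +' y := alpha^-1 (x + y) and
   x .' y := alpha^-1 (x . y) can be canonical on it; the unit is 1_A. *)
Definition compatible_ring (A : unitaryHomRing) (regA : regular A) : Type :=
  hr_sort A.

Section CompatibleRing.
Variables (A : unitaryHomRing) (regA : regular A).
Local Notation compatible_ring := (compatible_ring regA).

HB.instance Definition _ := Choice.copy compatible_ring (hr_sort A).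

Fact hr_alpha_surj (y : A) : exists x : A, hr_alpha x == y.
Proof. by case: regA => g _ gK; exists (g y); rewrite gK. Qed.

Definition hr_alphaV (y : A) : A := xchoose (hr_alpha_surj y).

Lemma hr_alphaVK : cancel hr_alphaV hr_alpha.
Proof. by move=> y; exact/eqP/(xchooseP (hr_alpha_surj y)). Qed.

Lemma hr_alpha_inj : injective (@hr_alpha A).
Proof. exact: bij_inj regA. Qed.

Lemma hr_alphaK : cancel hr_alpha hr_alphaV.
Proof. by move=> x; apply: hr_alpha_inj; rewrite hr_alphaVK. Qed.

Definition compat_add (x y : compatible_ring) : compatible_ring :=
  hr_alphaV (hr_add x y).

Definition compat_mul (x y : compatible_ring) : compatible_ring :=
  hr_alphaV (hr_mul x y).

Fact hr_opp_exists (x : A) : exists y : A, hr_add x y == hr_zero.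
Proof.
have G := hr_group A; have [opp [_ _ oppP]] := hg_opp G.
exists (opp x); have [//|k] := oppP x; elim: k => [/= -> //|k IHk].
by rewrite iterS -[RHS](hg_beta0 G) => /hr_alpha_inj.
Qed.

Definition compat_opp (x : compatible_ring) : compatible_ring :=
  xchoose (hr_opp_exists x).

Let alphaD (x y : A) : hr_alpha (hr_add x y) = hr_add (hr_alpha x) (hr_alpha y).
Proof. exact: (hg_betaD (hr_group A)). Qed.

Fact compat_addA : associative compat_add.
Proof.
move=> x y z; rewrite /compat_add; congr hr_alphaV; apply: hr_alpha_inj.
by rewrite !alphaD !hr_alphaVK (hg_addA (hr_group A)).
Qed.

Fact compat_addC : commutative compat_add.
Proof. by move=> x y; rewrite /compat_add (hg_addC (hr_group A)). Qed.

Fact compat_add0r : left_id (hr_zero : compatible_ring) compat_add.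
Proof. by move=> x; rewrite /compat_add (hg_add0r (hr_group A)) ?hr_alphaK. Qed.

Fact compat_addNr : left_inverse (hr_zero : compatible_ring) compat_opp compat_add.
Proof.
move=> x; rewrite compat_addC /compat_add.
rewrite (eqP (xchooseP (hr_opp_exists x))).
by rewrite -{1}(hg_beta0 (hr_group A)) hr_alphaK.
Qed.

Fact compat_mulA : associative compat_mul.
Proof.
move=> x y z; rewrite /compat_mul; congr hr_alphaV; apply: hr_alpha_inj.
by rewrite !hr_alphaM !hr_alphaVK hr_mulA.
Qed.

Fact compat_mul1r : left_id (hr_one : compatible_ring) compat_mul.
Proof. by move=> x; rewrite /compat_mul hr_mul1r hr_alphaK. Qed.

Fact compat_mulr1 : right_id (hr_one : compatible_ring) compat_mul.
Proof. by move=> x; rewrite /compat_mul hr_mulr1 hr_alphaK. Qed.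

Fact compat_mulDl : left_distributive compat_mul compat_add.
Proof.
move=> x y z; rewrite /compat_mul /compat_add; congr hr_alphaV.
apply: hr_alpha_inj.
by rewrite hr_alphaM alphaD !hr_alphaVK hr_mulDl.
Qed.

Fact compat_mulDr : right_distributive compat_mul compat_add.
Proof.
move=> x y z; rewrite /compat_mul /compat_add; congr hr_alphaV.
apply: hr_alpha_inj.
by rewrite hr_alphaM alphaD !hr_alphaVK hr_mulDr.
Qed.

HB.instance Definition _ := GRing.isZmodule.Build compatible_ring
  compat_addA compat_addC compat_add0r compat_addNr.

HB.instance Definition _ := GRing.Zmodule_isPzRing.Build compatible_ring
  compat_mulA compat_mul1r compat_mulr1 compat_mulDl compat_mulDr.

End CompatibleRing.

(* As for Hom-groups, [N = setT] gives the modules on the whole carrier and a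
   general [N] the submodules. *)
Record hom_module_on (A : unitaryHomRing) (M : Type) (N : set M)
    (add : M -> M -> M) (zero : M) (beta : M -> M) (act : A -> M -> M) : Prop :=
  HomModuleOn {
  hm_group : abelian_hom_group_on N add zero beta;
  hm_act_in : forall a m, N m -> N (act a m);
  hm_actDr : forall a m1 m2, N m1 -> N m2 ->
    act (hr_alpha a) (add m1 m2) = add (act a m1) (act a m2);
  hm_actDl : forall a b m, N m ->
    act (hr_add a b) (beta m) = add (act a m) (act b m);
  hm_actA : forall a b m, N m ->
    act (hr_mul a b) (beta m) = act (hr_alpha a) (act b m);
  hm_act1 : forall m, N m -> act hr_one m = beta m }.

Definition hom_module (A : unitaryHomRing) (M : Type)
    (add : M -> M -> M) (zero : M) (beta : M -> M) (act : A -> M -> M) : Prop :=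
  hom_module_on setT add zero beta act.

Definition simple_hom_module (A : unitaryHomRing) (M : Type)
    (add : M -> M -> M) (zero : M) (beta : M -> M) (act : A -> M -> M) : Prop :=
  [/\ hom_module add zero beta act,
      exists m : M, m <> zero &
      forall N : set M, hom_module_on N add zero beta act ->
        N = [set zero] \/ N = setT].

Definition simple_lmod (R : pzRingType) (M : lmodType R) : Prop :=
  (exists m : M, m <> 0) /\
  forall N : set M, GRing.submod_closed [in N] -> N = [set 0] \/ N = setT.

(* Main.v *)
Require Import Defs.
From HB Require Import structures.
From mathcomp Require Import all_boot all_order all_algebra.
From mathcomp Require Import boolp classical_sets.

Set Implicit Arguments.
Unset Strict Implicit.
Unset Printing Implicit Defensive.

Import GRing.Theory.
Local Open Scope ring_scope.

(** Each Hom-module identity is the image under [beta] (once or twice) of the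
    corresponding identity of the ordinary module: the intertwining relation
    between [alpha] and [beta] lets every twist inside a formula be moved to
    the outside, and Hom-addition and Hom-multiplication are [alpha] applied to
    the operations of the compatible ring ([twisted_hom_module]).

    For simplicity, a Hom-submodule [N] is stable under [beta] but not visibly
    under its inverse, so it need not be clear at first that [N] is a submodule
    for the untwisted structure.  This is avoided by working with cyclic
    submodules: if [N] contains some [x] other than 0, then [x] generates [M]
    over the compatible ring ([simple_lmod_cyclic]), while [N] contains
    [beta (a *: x)] for every [a].  Hence [N] contains [beta M], which is [M]
    since [beta] is surjective. *)

(** The multiples of [x] form a submodule that contains [x = 1 *: x], so it is
    not the zero submodule. *)
Lemma simple_lmod_cyclic (R : pzRingType) (M : lmodType R) (x : M) :
  simple_lmod M -> x <> 0 -> forall m : M, exists a : R, m = a *: x.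
Proof.
move=> [_ simpleM] x_neq0 m.
pose Rx : set M := [set y | exists a : R, y = a *: x]%classic.
have submodRx : GRing.submod_closed [in Rx].
  split; first by apply/mem_set; exists 0; rewrite scale0r.
  move=> c _ _ /set_mem[a ->] /set_mem[b ->]; apply/mem_set.
  by exists (c * a + b); rewrite scalerDl scalerA.
have [Rx0|RxT] := simpleM Rx submodRx.
  have : Rx x by exists 1; rewrite scale1r.
  by rewrite Rx0.
by have : Rx m by rewrite RxT.
Qed.

Section Twist.
Variables (A : unitaryHomRing) (regA : regular A).
Local Notation A' := (compatible_ring regA).

Lemma hr_addE (a b : A') : hr_add a b = hr_alpha (a + b : A') :> A.
Proof. by rewrite [RHS]hr_alphaVK. Qed.

Lemma hr_mulE (a b : A') : hr_mul a b = hr_alpha (a * b : A') :> A.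
Proof. by rewrite [RHS]hr_alphaVK. Qed.

(** The opposite of the untwisted group serves as the Hom-opposite, with
    exponent 0 in the cancellation axiom. *)
Lemma twisted_hom_group (M : zmodType) (beta : {additive M -> M}) :
  abelian_hom_group (fun x y : M => beta (x + y)) 0 beta.
Proof.
split=> //.
- by move=> x y _ _; rewrite addrC.
- by move=> x y z _ _ _; rewrite -!raddfD addrA.
- by move=> x y _ _; rewrite -raddfD.
- by move=> x _; rewrite addr0.
- by move=> x _; rewrite add0r.
- exact: raddf0.
- exists -%R; split=> //.
  + by move=> x y _ _; rewrite -raddfN opprD addrC.
  + by move=> x _; exists 0%N; rewrite /= subrr raddf0.
Qed.

Lemma twisted_hom_module (M : lmodType A') (beta : {additive M -> M})
    (beta_act : forall (a : A') (m : M),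
       beta (a *: m) = (hr_alpha a : A') *: beta m) :
  hom_module (A := A) (fun x y : M => beta (x + y)) 0 beta
    (fun (a : A) (m : M) => beta ((a : A') *: m)).
Proof.
split=> //.
- exact: twisted_hom_group.
- by move=> a m1 m2 _ _; rewrite -beta_act scalerDr raddfD.
- by move=> a b m _; rewrite hr_addE -beta_act scalerDl raddfD.
- by move=> a b m _; rewrite hr_mulE -!beta_act scalerA.
- by move=> m _; rewrite scale1r.
Qed.

End Twist.

Theorem proposition8p7 (A : unitaryHomRing) (regA : regular A)
    (M : lmodType (compatible_ring regA)) (simpleM : simple_lmod M)
    (beta : {additive M -> M}) (beta_bij : bijective beta)
    (beta_act : forall (a : compatible_ring regA) (m : M),
       beta (a *: m) = (hr_alpha a : compatible_ring regA) *: beta m) :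
  simple_hom_module (A := A)
    (fun x y : M => beta (x + y)) 0 beta
    (fun (a : A) (m : M) => beta ((a : compatible_ring regA) *: m)).
Proof.
split; [exact: twisted_hom_module | by case: simpleM | move=> N modN].
have [[x [Nx x_neq0]]|N_eq0] := pselect (exists x, N x /\ x <> 0); last first.
  left; apply/seteqP; split=> [y Ny|_ ->].
    by apply: contrapT => y_neq0; apply: N_eq0; exists y.
  exact: hg_zero_in (hm_group modN).
right; apply/seteqP; split=> // m _.
have [betaV _ betaVK] := beta_bij.
have [a betaVm] := simple_lmod_cyclic simpleM x_neq0 (betaV m).
rewrite -(betaVK m) betaVm; exact: hm_act_in modN a x Nx.
Qed.
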